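(* For every pair of positive integers $l,m$ with $l\leq m$, and any finite simple graph $G$ with at least one edge, we have $$\chi'_{[l,m]}(G)= \begin{cases} \left\lceil \frac{|E(G)|}{m} \right\rceil & \text{ if } \frac{|E(G)|}{\chi'(G)}\geq m, \\ \chi'(G) & \text{ if } l \leq \frac{|E(G)|}{\chi'(G)} \leq m,\\ \chi'_{[l]}(G) & \text{ if } \frac{|E(G)|}{\chi'(G)} \leq l. \end{cases}$$
   Context: A matching of $G$ is a set of pairwise non-adjacent edges of $G$. For positive integers $l\leq m$, an $[l,m]$-covering of $G$ is a set $\mathcal{M}$ of matchings of $G$ whose union is $E(G)$ and such that $l\leq |M|\leq m$ for every $M\in\mathcal{M}$. The excessive $[l,m]$-index $\chi'_{[l,m]}(G)$ is the minimum cardinality of an $[l,m]$-covering of $G$ if one exists, and $\infty$ otherwise. The excessive $[l]$-index is $\chi'_{[l]}(G):=\chi'_{[l,l]}(G)$. $\chi'(G)$ denotes the chromatic index of $G$, i.e. the minimum $k$ such that $G$ has a (proper) $k$-edge colouring. *)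

(* Defs.v *)
From mathcomp Require Import all_boot all_order all_algebra.

Set Implicit Arguments.
Unset Strict Implicit.
Unset Printing Implicit Defensive.

Record sgraph := SGraph {
  vertex :> finType;
  adj : rel vertex;
  adj_sym : symmetric adj;
  adj_irrefl : irreflexive adj
}.

(* An edge is the two-element set of its endpoints. *)
Definition edges (G : sgraph) : {set {set G}} :=
  [set [set p.1; p.2] | p in [pred p : G * G | adj p.1 p.2]].

Definition adjacent_edges (G : sgraph) (A B : {set G}) : bool :=
  (A != B) && (A :&: B != set0).

Definition matching (G : sgraph) (M : {set {set G}}) : bool :=
  (M \subset edges G) &&
  [forall A in M, forall B in M, ~~ adjacent_edges A B].

Definition covering (l m : nat) (G : sgraph) (C : {set {set {set G}}}) : bool :=
  [forall M in C, matching M && (l <= #|M| <= m)] && (cover C == edges G).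

(* [None] stands for infinity: [G] has no [l,m]-covering. *)
Definition excessive_index2 (l m : nat) (G : sgraph) : option nat :=
  if [pick C : {set {set {set G}}} | covering l m C] is Some C0
  then Some #|[arg min_(C < C0 | covering l m C) #|C|]|
  else None.

Definition excessive_index (l : nat) (G : sgraph) : option nat :=
  excessive_index2 l l G.

(* Colourings are defined on the subtype of edges rather than on all of
   [{set G}], so that an edgeless graph is 0-edge-colourable. *)
Definition proper_edge_colouring (G : sgraph) (k : nat)
    (c : {ffun {A : {set G} | A \in edges G} -> 'I_k}) : bool :=
  [forall A, forall B, adjacent_edges (val A) (val B) ==> (c A != c B)].

Definition edge_colourable (G : sgraph) (k : nat) : bool :=
  [exists c : {ffun {A : {set G} | A \in edges G} -> 'I_k},
     proper_edge_colouring c].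

Lemma ex_edge_colourable (G : sgraph) : exists k, edge_colourable G k.
Proof.
exists #|{: {A : {set G} | A \in edges G}}|.
apply/existsP; exists [ffun A => enum_rank A].
apply/forallP=> A; apply/forallP=> B; apply/implyP=> /andP[neqAB _].
by rewrite !ffunE (inj_eq enum_rank_inj) -val_eqE.
Qed.

Definition chromatic_index (G : sgraph) : nat :=
  ex_minn (ex_edge_colourable G).

(* Main.v *)
Require Import Defs.
From mathcomp Require Import all_boot all_order all_algebra.
From mathcomp Require Import zify.
Import Order.TTheory GRing.Theory Num.Theory.
Local Open Scope ring_scope.

(** Coverings are studied through families of [k] matchings with union [E(G)],
    indexed by ['I_k] and allowed to repeat and to overlap.  Such families exist
    exactly when [k] is at least the chromatic index [q]
    ([chromatic_index_leP]).  The weight of a family is the sum of the sizes of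
    its members, and three operations control it.

    - Trimming ([matching_cover_trim]): the weight can be lowered to any value
      that is at least [|E(G)|], by removing an edge from one of two members
      that contain it.
    - Equalising ([matching_cover_balance]): without changing [k] or the weight,
      the sizes can be made to differ by at most one.  This rests on
      [matching_transfer]: if [|N| < |M|], exchanging [M] and [N] along an
      alternating path makes [M] smaller by one edge and [N] larger by one,
      keeping union and intersection.
    - Duplication ([matching_cover_dup]): repeating a member of at least average
      size gives a family of [k + 1] members.

    By equalising, a family of [k] members whose weight is between [k * l] and
    [k * m] yields an [[l,m]]-covering with at most [k] members
    ([covering_of_matching_cover]).  Conversely, a covering with [k] members has
    [q <= k] and [|E(G)| <= k * m] ([covering_bounds]).

    If [q * m <= |E(G)|], let [k] be the ceiling of [|E(G)| / m].  If [k = q],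
    a [q]-edge-colouring has weight at least [k * m]; otherwise a cover by
    [k - 1] matchings has a member of size at least [m], and duplicating it
    raises the weight to at least [k * m].  Trimming to [k * m] and equalising,
    all sizes become [m] ([exact_covering]).  If
    [q * l <= |E(G)| <= q * m], equalise a [q]-edge-colouring.  If
    [|E(G)| <= q * l], an [[l,m]]-covering with [k] members has weight at least
    [k * l >= |E(G)|], so trimming to [k * l] and equalising gives an
    [[l,l]]-covering with at most [k] members ([covering_trim_size]). *)

Set Implicit Arguments.
Unset Strict Implicit.
Unset Printing Implicit Defensive.

(** * Transferring one edge between two matchings *)

Section Transfer.
Local Open Scope nat_scope.
Variable T : finType.
Implicit Types (e f A B : {set T}) (M N P : {set {set T}}).

(** Distinct members of [M] are disjoint, stated pointwise. *)
Definition disjoint_family M :=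
  forall x A B, A \in M -> B \in M -> x \in A -> x \in B -> A = B.

Lemma disjoint_familyU1 e P :
    disjoint_family P -> (forall A x, A \in P -> x \in A -> x \notin e) ->
  disjoint_family (e |: P).
Proof.
move=> dP eP x A B; rewrite !inE => /predU1P[->|AP] /predU1P[->|BP] //.
- by move=> xe xB; have := eP _ _ BP xB; rewrite xe.
- by move=> xA xe; have := eP _ _ AP xA; rewrite xe.
exact: dP.
Qed.

Lemma disjoint_familyS M N :
  N \subset M -> disjoint_family M -> disjoint_family N.
Proof. by move=> /subsetP sNM dM x A B /sNM AM /sNM; apply: dM. Qed.

Lemma card_cover_pairs M :
    disjoint_family M -> (forall A, A \in M -> #|A| = 2) ->
  #|cover M| = #|M| * 2.
Proof.
move=> dM M2; have /eqP <- : trivIset M.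
  apply/trivIsetP=> A B AM BM; apply: contraR => /pred0Pn[x /andP[xA xB]].
  by apply/eqP; apply: dM xA xB.
by rewrite (eq_bigr (fun=> 2)) ?sum_nat_const // => A /M2.
Qed.

Lemma pair_other_end A x :
  #|A| = 2 -> x \in A -> exists2 y, y != x & A = [set x; y].
Proof.
move/eqP/cards2P=> [a [b [neq_ab ->]]] /set2P[]->; first by exists b; rewrite 1?eq_sym.
by exists a => //; rewrite setUC.
Qed.

(** [M] and [N] are matchings, given as sets of pairs.  Let [v] be covered by [M]
    but not by [N], with [e = vw] in [M].  If [N] does not cover [w], moving [e]
    to [N] suffices.  Otherwise let [f = wx] be in [N]; induction on [M \ e] and
    [N \ f] gives [M'] and [N'], of which at most one covers [x], and [e] and
    [f] can be added to them in one of the two possible ways. *)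
Lemma matching_transfer M N :
    disjoint_family M -> disjoint_family N ->
    (forall A, A \in M :|: N -> #|A| = 2) -> #|N| < #|M| ->
  exists M' N', [/\ disjoint_family M', disjoint_family N',
    M' :|: N' = M :|: N, M' :&: N' = M :&: N & #|M'|.+1 = #|M|].
Proof.
have [n] := ubnP #|M|; elim: n M N => // n IHn M N ltMn dM dN MN2 ltNM.
have M2 A : A \in M -> #|A| = 2 by move=> AM; apply: MN2; rewrite inE AM.
have N2 A : A \in N -> #|A| = 2 by move=> AN; apply: MN2; rewrite inE AN orbT.
have [v /bigcupP[e eM ve] vN] : exists2 v, v \in cover M & v \notin cover N.
  apply/subsetPn; apply/negP=> /subset_leq_card.
  by rewrite !card_cover_pairs // leq_pmul2r // leqNgt ltNM.
have {}vN A : A \in N -> v \notin A.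
  by move=> AN; apply: contra vN => vA; apply/bigcupP; exists A.
have [w neq_wv De] := pair_other_end (M2 e eM) ve.
have eN : e \notin N by apply: contraL ve => /vN.
have we : w \in e by rewrite De set22.
have [/existsP[f /andP[fN wf]]|noN] := boolP [exists f, (f \in N) && (w \in f)]; last first.
  exists (M :\ e), (e |: N); split.
  - by apply: disjoint_familyS dM; apply: subsetDl.
  - apply: disjoint_familyU1 => // A x AN xA; rewrite De !inE.
    apply/norP; split; apply: contraTneq xA => ->; first exact: vN.
    by apply: contra noN => wA; apply/existsP; exists A; rewrite AN.
  - by apply/setP=> A; rewrite !inE; case: eqP => [->|]; rewrite ?eM.
  - by apply/setP=> A; rewrite !inE; case: eqP => [->|] //=; rewrite (negPf eN) andbF.
  by rewrite (cardsD1 e M) eM.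
have [x neq_xw Df] := pair_other_end (N2 f fN) wf.
have xf : x \in f by rewrite Df set22.
have neq_ef : e != f by apply: contraNneq eN => ->.
have fM : f \notin M.
  by apply: contraNN neq_ef => fM; apply/eqP; apply: dM we wf.
have cM : #|M| = #|M :\ e|.+1 by rewrite (cardsD1 e M) eM.
have cN : #|N| = #|N :\ f|.+1 by rewrite (cardsD1 f N) fN.
have [|||||M' [N' [dM' dN' U' I' c']]] := IHn (M :\ e) (N :\ f); first by rewrite -ltnS -cM.
- by apply: disjoint_familyS dM; apply: subsetDl.
- by apply: disjoint_familyS dN; apply: subsetDl.
- move=> A; rewrite !inE => H; apply: MN2; rewrite inE.
  by case/orP: H => /andP[_ ->]; rewrite ?orbT.
- by rewrite -ltnS -cM -cN.
(* Nothing in M' or N' contains v or w, and a member that contains x comes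
   from M alone, as f was the only element of N at x. *)
have MNsub A : A \in M' :|: N' ->
    [/\ v \notin A, w \notin A & x \in A -> A \in M :\ e /\ A \notin N :\ f].
  have xN : x \in A -> A \notin N :\ f.
    move=> xA; apply/negP; rewrite !inE => /andP[/eqP + AN]; apply.
    exact: dN xA xf.
  rewrite U' => AU; split.
  - move: AU; rewrite !inE => /orP[] /andP[/eqP neqA AM]; last exact: vN.
    by apply/negP=> vA; case: neqA; apply: dM vA ve.
  - move: AU; rewrite !inE => /orP[] /andP[/eqP neqA AM]; apply/negP=> wA; case: neqA.
      exact: dM wA we.
    exact: dN wA wf.
  by move=> xA; split; [case/setUP: AU => // AN; case/negP: (xN xA)|exact: xN].
have eU : e \notin M' :|: N' by apply/negP=> /MNsub[]; rewrite ve.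
have fU : f \notin M' :|: N' by apply/negP=> /MNsub[_]; rewrite wf.
have add_e P : P \subset M' :|: N' -> disjoint_family P -> disjoint_family (e |: P).
  move=> /subsetP sP dP; apply: disjoint_familyU1 => // A y AP yA.
  have [vA wA _] := MNsub A (sP A AP); rewrite De !inE.
  by apply/norP; split; apply: contraTneq yA => ->.
have add_f P : P \subset M' :|: N' -> (forall A, A \in P -> x \notin A) ->
    disjoint_family P -> disjoint_family (f |: P).
  move=> /subsetP sP xP dP; apply: disjoint_familyU1 => // A y AP yA.
  have [_ wA _] := MNsub A (sP A AP); rewrite Df !inE.
  by apply/norP; split; apply: contraTneq yA => -> //; apply: xP.
have Mem A : [/\ (A \in M') || (A \in N') = (A != e) && (A \in M) || (A != f) && (A \in N)
    & (A \in M') && (A \in N') = (A != e) && (A \in M) && ((A != f) && (A \in N))].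
  by split; [move/setP: U' => /(_ A)|move/setP: I' => /(_ A)]; rewrite !inE.
have [eM' eN'] : e \notin M' /\ e \notin N' by move: eU; rewrite inE => /norP.
have [fM' fN'] : f \notin M' /\ f \notin N' by move: fU; rewrite inE => /norP.
(* If N' covers x, then f must go to M' and e to N'; otherwise e goes to M' and
   f to N'. *)
have [/existsP[A /andP[AN xA]]|noN] := boolP [exists A, (A \in N') && (x \in A)].
  exists (f |: M'), (e |: N'); split.
  - apply: add_f => //; first exact: subsetUl.
    move=> B BM; apply/negP=> xB.
    have [|_ _ /(_ xA)[AM AN1]] := MNsub A; first by rewrite inE AN orbT.
    have [|_ _ /(_ xB)[BM1 _]] := MNsub B; first by rewrite inE BM.
    have eqAB : A = B by move: AM BM1; rewrite !inE => /andP[_ AM] /andP[_ BM1]; apply: dM xA xB.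
    have : A \in M' :&: N' by rewrite inE AN eqAB BM.
    by rewrite I' inE (negPf AN1) andbF.
  - by apply: add_e => //; apply: subsetUr.
  - apply/setP=> B; have [U I] := Mem B; rewrite !inE.
    have [->|] := eqVneq B e; first by rewrite eM !orbT.
    by have [->|] := eqVneq B f; rewrite ?fN ?orbT // => nf ne /=; rewrite U ne nf.
  - apply/setP=> B; have [U I] := Mem B; rewrite !inE.
    have [->|ne] := eqVneq B e; first by rewrite (negPf neq_ef) (negPf eM') (negPf eN) andbF.
    have [->|nf] := eqVneq B f; first by rewrite (negPf fN') (negPf fM).
    by rewrite /= I ne nf.
  by rewrite cardsU1 fM' add1n c' -cM.
exists (e |: M'), (f |: N'); split.
- by apply: add_e => //; apply: subsetUl.
- apply: add_f => //; first exact: subsetUr.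
  by move=> A AN; apply: contra noN => xA; apply/existsP; exists A; rewrite AN.
- apply/setP=> B; have [U I] := Mem B; rewrite !inE.
  have [->|] := eqVneq B e; first by rewrite eM.
  by have [->|] := eqVneq B f; rewrite ?fN ?orbT // => nf ne /=; rewrite U ne nf.
- apply/setP=> B; have [U I] := Mem B; rewrite !inE.
  have [->|ne] := eqVneq B e; first by rewrite (negPf neq_ef) (negPf eN') (negPf eN) andbF.
  have [->|nf] := eqVneq B f; first by rewrite (negPf fM') (negPf fM).
  by rewrite /= I ne nf.
by rewrite cardsU1 eM' add1n c' -cM.
Qed.

End Transfer.

(** * Indexed covers by matchings *)

Section Covers.
Local Open Scope nat_scope.
Variable G : sgraph.
Implicit Types (A B : {set G}) (M N : {set {set G}}) (C : {set {set {set G}}}).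

Lemma card_edge A : A \in edges G -> #|A| = 2.
Proof.
case/imsetP=> -[x y] /=; rewrite inE /= => xy ->; rewrite cards2.
by case: eqP xy => // ->; rewrite adj_irrefl.
Qed.

Lemma matchingP M :
  reflect (M \subset edges G /\ disjoint_family M) (matching M).
Proof.
apply: (iffP andP) => -[sME dM]; split=> //.
  move=> x A B AM BM xA xB; apply/eqP; apply: contraTT dM => neqAB.
  apply/forall_inPn; exists A => //; apply/forall_inPn; exists B => //.
  by rewrite negbK /adjacent_edges neqAB; apply/set0Pn; exists x; rewrite inE xA.
apply/forall_inP=> A AM; apply/forall_inP=> B BM; apply/andP=> -[neqAB].
by case/set0Pn=> x /setIP[xA xB]; case/eqP: neqAB; apply: dM xA xB.
Qed.

(** A family of [k] matchings with union [edges G].  The family is indexed, so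
    that matchings may be repeated, and its members may overlap. *)
Definition matching_cover k (f : {ffun 'I_k -> {set {set G}}}) : bool :=
  [forall i, matching (f i)] && (\bigcup_i f i == edges G).

(** The number of edges of a family, counted with multiplicity. *)
Definition weight k (f : {ffun 'I_k -> {set {set G}}}) : nat :=
  \sum_i #|f i|.

Lemma matching_coverP k (f : {ffun 'I_k -> {set {set G}}}) :
  reflect ((forall i, matching (f i)) /\ \bigcup_i f i = edges G)
          (matching_cover f).
Proof.
apply: (iffP andP) => [[/forallP ? /eqP ?] //|[? Uf]].
by rewrite Uf; split=> //; apply/forallP.
Qed.

Lemma matching_cover_edge k (f : {ffun 'I_k -> {set {set G}}}) A :
  matching_cover f -> A \in edges G -> exists i, A \in f i.
Proof. by case/matching_coverP=> _ <- /bigcupP[i _ Ai]; exists i. Qed.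

Lemma weightE k (f : {ffun 'I_k -> {set {set G}}}) :
  matching_cover f -> weight f = \sum_(A in edges G) #|[set i | A \in f i]|.
Proof.
case/matching_coverP=> mf _.
transitivity (\sum_i \sum_(A in edges G) (A \in f i : nat)).
  apply: eq_bigr => i _; rewrite -sum1_card.
  have /matchingP[/subsetP sfE _] := mf i.
  rewrite big_mkcond [RHS]big_mkcond; apply: eq_bigr => A _.
  by case: ifP => [/sfE ->|] //; case: ifP.
rewrite exchange_big; apply: eq_bigr => A _ /=.
by rewrite -sum1dep_card [RHS]big_mkcond.
Qed.

Lemma leq_card_weight k (f : {ffun 'I_k -> {set {set G}}}) :
  matching_cover f -> #|edges G| <= weight f.
Proof.
move=> cf; rewrite weightE // -sum1_card; apply: leq_sum => A AE.
have [i Ai] := matching_cover_edge cf AE.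
by apply/card_gt0P; exists i; rewrite inE.
Qed.

(** As long as the weight exceeds the number of edges, some edge lies in two
    members of the family, and can be removed from one of them. *)
Lemma matching_cover_trim k (f : {ffun 'I_k -> {set {set G}}}) w :
    matching_cover f -> #|edges G| <= w <= weight f ->
  exists2 g : {ffun 'I_k -> {set {set G}}}, matching_cover g & weight g = w.
Proof.
move=> + /andP[leEw]; have [n] := ubnP (weight f).
elim: n f => // n IHn f ltfn cf; rewrite leq_eqVlt => /predU1P[->|ltwf].
  by exists f.
have [A AE] : exists2 A, A \in edges G & 1 < #|[set i | A \in f i]|.
  apply/exists_inP; apply: contraLR ltwf; rewrite -leqNgt => /exists_inPn few.
  apply: leq_trans leEw; rewrite weightE // -sum1_card.
  by apply: leq_sum => A /few; rewrite -leqNgt.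
case/card_gt1P=> i [j []]; rewrite !inE => Ai Aj neq_ij.
pose g := [ffun h => if h == i then f i :\ A else f h].
have gi : g i = f i :\ A by rewrite ffunE eqxx.
have gh h : h != i -> g h = f h by rewrite ffunE => /negPf ->.
have wg : weight f = (weight g).+1.
  rewrite /weight (bigD1 i) //= [in RHS](bigD1 i) //= gi (cardsD1 A (f i)) Ai.
  by rewrite [in RHS](eq_bigr (fun h => #|f h|)) // => h /gh ->.
have [mf Uf] := matching_coverP _ cf.
apply: (IHn g); [by rewrite -ltnS -wg | | by rewrite -ltnS -wg].
apply/matching_coverP; split=> [h|].
  have [->|/gh -> //] := eqVneq h i; have /matchingP[sfE df] := mf i.
  rewrite gi; apply/matchingP; split.
    by apply: subset_trans sfE; apply: subsetDl.
  by apply: disjoint_familyS df; apply: subsetDl.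
rewrite -Uf; apply/eqP; rewrite eqEsubset; apply/andP; split.
  apply/bigcupsP=> h _; have [->|/gh ->] := eqVneq h i; last exact: bigcup_sup.
  by rewrite gi; apply: subset_trans (bigcup_sup i _); rewrite ?subsetDl.
apply/subsetP=> B /bigcupP[h _ Bh]; apply/bigcupP.
have [eqBA|neqBA] := eqVneq B A.
  by exists j; rewrite // gh 1?eq_sym // eqBA.
exists h => //; have [eqhi|/gh -> //] := eqVneq h i.
by rewrite eqhi gi !inE neqBA -eqhi.
Qed.

(** Equalisation: a family of the same weight that minimises the sum of the
    squared sizes has sizes that differ by at most one, since otherwise
    [matching_transfer] would decrease that sum. *)
Lemma matching_cover_balance k (f : {ffun 'I_k -> {set {set G}}}) :
    matching_cover f ->
  exists2 g : {ffun 'I_k -> {set {set G}}}, matching_cover g &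
    weight g = weight f /\ forall i j, #|g i| <= #|g j|.+1.
Proof.
move=> cf.
pose P (g : {ffun 'I_k -> {set {set G}}}) :=
  matching_cover g && (weight g == weight f).
have Pf : P f by rewrite /P cf /=.
pose F (g : {ffun 'I_k -> {set {set G}}}) := \sum_i #|g i| ^ 2.
case: (arg_minnP F Pf) => g /andP[cg /eqP wg] g_min.
exists g => //; split=> // i j; rewrite leqNgt; apply/negP=> lt_ji.
have neq_ji : j != i by apply: contraTneq lt_ji => ->; rewrite -leqNgt leqnSn.
have [mg Ug] := matching_coverP _ cg.
have /matchingP[sgi dgi] := mg i; have /matchingP[sgj dgj] := mg j.
have [|M [N [dM dN UMN IMN cM]]] := matching_transfer dgi dgj _ (ltnW lt_ji).
  by move=> A /setUP[/(subsetP sgi)|/(subsetP sgj)]; apply: card_edge.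
have cN : #|N| = #|g j|.+1.
  have := cardsUI M N; rewrite UMN IMN cardsUI -cM addSnnS => /eqP.
  by rewrite eqn_add2l => /eqP.
have sMN : M :|: N \subset edges G by rewrite UMN subUset sgi.
pose g' := [ffun h => if h == i then M else if h == j then N else g h].
have g'i : g' i = M by rewrite ffunE eqxx.
have g'j : g' j = N by rewrite ffunE eqxx (negPf neq_ji).
have g'h h : (h != i) && (h != j) -> g' h = g h.
  by rewrite ffunE => /andP[/negPf -> /negPf ->].
have mM : matching M.
  by apply/matchingP; split=> //; apply: subset_trans sMN; apply: subsetUl.
have mN : matching N.
  by apply/matchingP; split=> //; apply: subset_trans sMN; apply: subsetUr.
have Pg' : P g'.
  apply/andP; split.
    apply/matching_coverP; split=> [h|].
      have [->|nhi] := eqVneq h i; first by rewrite g'i.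
      have [->|nhj] := eqVneq h j; first by rewrite g'j.
      by rewrite g'h // nhi nhj.
    rewrite -Ug (bigD1 i) //= (bigD1 j) //= [RHS](bigD1 i) //=.
    rewrite [X in _ = _ :|: X](bigD1 j) //= !setUA g'i g'j UMN; congr (_ :|: _).
    by apply: eq_bigr => h /g'h.
  rewrite -wg /weight (bigD1 i) //= (bigD1 j) //= [X in _ == X](bigD1 i) //=.
  rewrite [X in _ == _ + X](bigD1 j) //= g'i g'j cN -cM addnA addnS -addSn addnA.
  by rewrite (eq_bigr (fun h => #|g h|)) // => h /g'h ->.
have := g_min g' Pg'; rewrite /F (bigD1 i) //= (bigD1 j) //= [X in _ <= X](bigD1 i) //=.
rewrite [X in _ <= _ + X](bigD1 j) //= g'i g'j cN.
rewrite [X in _ <= _ + (_ + X)](eq_bigr (fun h => #|g h| ^ 2)) => [|h /g'h -> //].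
rewrite !addnA leq_add2r leqNgt => /negP[].
move: lt_ji; rewrite -cM; move: #|M| #|g j| => a b; clear; nia.
Qed.

(** The covering is the set of members of an equalised family: it may have fewer
    than [k] elements, since equal members are identified. *)
Lemma covering_of_matching_cover k l m (f : {ffun 'I_k -> {set {set G}}}) :
    matching_cover f -> k * l <= weight f <= k * m ->
  exists2 C : {set {set {set G}}}, covering l m C & #|C| <= k.
Proof.
move=> cf /andP[lw wm].
have [g cg [wg balg]] := matching_cover_balance cf; rewrite -{}wg in lw wm.
have [mg Ug] := matching_coverP _ cg.
have sum_k n : k * n = \sum_(i < k) n by rewrite sum_nat_const card_ord.
exists [set g i | i : 'I_k].
  apply/andP; split; last by rewrite cover_imset -Ug.
  apply/forall_inP=> _ /imsetP[i _ ->]; rewrite mg /=.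
  rewrite leqNgt [X in _ && X]leqNgt; apply/andP; split; apply/negP=> gi.
    move: lw; rewrite leqNgt => /negP[].
    rewrite sum_k /weight (bigD1 i) //= [X in _ < X](bigD1 i) //= -addSn leq_add //.
    by apply: leq_sum => j _; apply: leq_trans (balg j i) gi.
  move: wm; rewrite leqNgt => /negP[].
  rewrite sum_k /weight (bigD1 i) //= [X in _ < X](bigD1 i) //= -addSn leq_add //.
  by apply: leq_sum => j _; rewrite -ltnS (leq_trans gi (balg i j)).
by rewrite (leq_trans (leq_imset_card _ _)) ?card_ord.
Qed.

Lemma matching_cover_of_covering l m C :
    covering l m C ->
  exists2 f : {ffun 'I_#|C| -> {set {set G}}}, matching_cover f &
    #|C| * l <= weight f <= #|C| * m.
Proof.
case/andP=> /forall_inP mC /eqP UC; exists [ffun i => enum_val i].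
  apply/matching_coverP; split=> [i|].
    by rewrite ffunE; case/andP: (mC _ (enum_valP i)).
  rewrite -UC /cover [RHS]big_enum_val /=.
  by apply: eq_bigr => i _; rewrite ffunE.
rewrite /weight (eq_bigr (fun i : 'I_#|C| => #|enum_val i : {set {set G}}|)) => [|i _]; last by rewrite ffunE.
have sumC n : #|C| * n = \sum_(i < #|C|) n by rewrite sum_nat_const card_ord.
by rewrite !sumC; apply/andP; split; apply: leq_sum => i _;
  have /and3P[] := mC _ (enum_valP i).
Qed.

(** * The chromatic index *)

Lemma edge_colourable_matching_cover k :
  edge_colourable G k ->
  exists f : {ffun 'I_k -> {set {set G}}}, matching_cover f.
Proof.
case/existsP=> c /forallP pc.
exists [ffun i => [set val A | A in [pred A | c A == i]]].
apply/matching_coverP; split=> [i|].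
  rewrite ffunE; apply/matchingP; split.
    by apply/subsetP=> _ /imsetP[A _ ->]; apply: valP.
  move=> x _ _ /imsetP[A cA ->] /imsetP[B cB ->] xA xB; apply/eqP.
  move: cA cB; rewrite !inE => /eqP <-; apply: contraTT => neqAB.
  have /forallP/(_ B)/implyP := pc A; rewrite eq_sym; apply.
  by rewrite /adjacent_edges neqAB; apply/set0Pn; exists x; rewrite inE xA.
apply/setP=> A; apply/bigcupP/idP => [[i _]|AE].
  by rewrite ffunE => /imsetP[B _ ->]; apply: valP.
pose A' : {A : {set G} | A \in edges G} := Sub A AE.
by exists (c A') => //; rewrite ffunE; apply/imsetP; exists A'; rewrite ?inE.
Qed.

Lemma matching_cover_edge_colourable k (f : {ffun 'I_k -> {set {set G}}}) :
  matching_cover f -> edge_colourable G k.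
Proof.
move=> cf; have [mf _] := matching_coverP _ cf.
have ex_col (A : {A : {set G} | A \in edges G}) : exists i, val A \in f i.
  by apply: matching_cover_edge cf (valP A).
apply/existsP; exists [ffun A => xchoose (ex_col A)].
apply/forallP=> A; apply/forallP=> B; apply/implyP=> /andP[neqAB].
case/set0Pn=> x /setIP[xA xB]; rewrite !ffunE; apply: contra neqAB => /eqP eq_col.
have /matchingP[_ df] := mf (xchoose (ex_col A)).
apply/eqP; apply: df xA xB; first exact: (xchooseP (ex_col A)).
by rewrite eq_col; apply: (xchooseP (ex_col B)).
Qed.

(** A cover by [k] matchings is a [k]-edge-colouring up to the choice, for each
    edge, of one member that contains it. *)
Lemma chromatic_index_leP k :
  reflect (exists f : {ffun 'I_k -> {set {set G}}}, matching_cover f)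
          (chromatic_index G <= k).
Proof.
rewrite /chromatic_index; case: ex_minnP => q colq q_min.
apply: (iffP idP) => [leqk|[f /matching_cover_edge_colourable/q_min //]].
apply: edge_colourable_matching_cover.
case/existsP: colq => c /forallP pc; apply/existsP.
exists [ffun A => widen_ord leqk (c A)].
apply/forallP=> A; apply/forallP=> B; rewrite !ffunE.
by have /forallP/(_ B) := pc A; rewrite -!val_eqE.
Qed.

Lemma chromatic_index_gt0 : edges G != set0 -> 0 < chromatic_index G.
Proof.
case/set0Pn=> A AE.
have /chromatic_index_leP[f cf] := leqnn (chromatic_index G).
have [i _] := matching_cover_edge cf AE.
exact: leq_ltn_trans (leq0n i) (ltn_ord i).
Qed.

(** * Coverings of minimum cardinality *)

Lemma covering_bounds l m C :
  covering l m C -> chromatic_index G <= #|C| /\ #|edges G| <= #|C| * m.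
Proof.
case/matching_cover_of_covering=> f cf /andP[_ wm]; split.
  by apply/chromatic_index_leP; exists f.
exact: leq_trans (leq_card_weight cf) wm.
Qed.

Lemma sub_covering l m l' m' C :
  l' <= l -> m <= m' -> covering l m C -> covering l' m' C.
Proof.
move=> ll mm /andP[/forall_inP mC UC]; apply/andP; split=> //.
apply/forall_inP=> M /mC /and3P[-> lM Mm].
by rewrite (leq_trans ll) // (leq_trans Mm).
Qed.

Lemma excessive_index2_eq l m k C :
    covering l m C -> #|C| <= k ->
    (forall D : {set {set {set G}}}, covering l m D -> k <= #|D|) ->
  excessive_index2 l m G = Some k.
Proof.
move=> covC leCk k_min; rewrite /excessive_index2.
case: pickP => [C0 covC0|/(_ C)]; last by rewrite covC.
case: arg_minnP => // D covD D_min; congr Some; apply/eqP.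
by rewrite eqn_leq k_min // (leq_trans (D_min _ covC)).
Qed.

Lemma eq_excessive_index2 l m l' m' :
    (forall C, covering l m C -> exists2 D : {set {set {set G}}},
       covering l' m' D & #|D| <= #|C|) ->
    (forall C, covering l' m' C -> exists2 D : {set {set {set G}}},
       covering l m D & #|D| <= #|C|) ->
  excessive_index2 l m G = excessive_index2 l' m' G.
Proof.
move=> lm' lm; rewrite [RHS]/excessive_index2.
case: pickP => [C0 covC0|no_cov].
  case: arg_minnP => // C covC C_min; have [D covD leDC] := lm _ covC.
  apply: excessive_index2_eq covD leDC _ => C' /lm'[D' covD'].
  by apply: leq_trans; apply: C_min.
rewrite /excessive_index2; case: pickP => // C /lm'[D].
by rewrite no_cov.
Qed.

(** In the range [|E(G)| <= q * l], with [q] the chromatic index, the upper bound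
    [m] on the sizes can be lowered to [l]. *)
Lemma covering_trim_size l m C :
    #|edges G| <= chromatic_index G * l -> covering l m C ->
  exists2 D : {set {set {set G}}}, covering l l D & #|D| <= #|C|.
Proof.
move=> leEl covC; have [leqC _] := covering_bounds covC.
have [f cf /andP[lw _]] := matching_cover_of_covering covC.
have [|g cg wg] := matching_cover_trim (w := #|C| * l) cf.
  by rewrite lw (leq_trans leEl) // leq_mul2r leqC orbT.
by apply: covering_of_matching_cover cg _; rewrite wg leqnn.
Qed.

(** The member that is repeated is one of at least average size. *)
Lemma matching_cover_dup k m (f : {ffun 'I_k -> {set {set G}}}) :
    0 < k -> matching_cover f -> k * m <= weight f ->
  exists2 g : {ffun 'I_k.+1 -> {set {set G}}}, matching_cover g &
    weight f + m <= weight g.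
Proof.
move=> k_gt0 cf lew; have [mf Uf] := matching_coverP _ cf.
have [i lemi] : exists i, m <= #|f i|.
  apply/existsP; apply: contraLR lew; rewrite negb_exists -ltnNge => /forallP lt_m.
  have ->: k * m = \sum_(i < k) m by rewrite sum_nat_const card_ord.
  pose i0 := Ordinal k_gt0.
  rewrite /weight (bigD1 i0) //= [X in _ < X](bigD1 i0) //= -addSn.
  by rewrite leq_add ?ltnNge ?lt_m // leq_sum // => j _; rewrite ltnW // ltnNge lt_m.
pose g := [ffun j : 'I_k.+1 => f (odflt i (unlift ord_max j))].
have gl : g ord_max = f i by rewrite ffunE unlift_none.
have gw j : g (widen_ord (leqnSn k) j) = f j.
  rewrite ffunE; have ->: widen_ord (leqnSn k) j = lift ord_max j.
    by apply/val_inj; rewrite /= /bump leqNgt ltn_ord.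
  by rewrite liftK.
exists g.
  apply/matching_coverP; split=> [j|]; first by rewrite ffunE.
  rewrite -Uf big_ord_recr /= gl (eq_bigr (fun j => f j)) => [|j _]; last exact: gw.
  by apply/setUidPl; apply: bigcup_sup.
rewrite [X in _ <= X]/weight big_ord_recr /= gl leq_add // leq_sum // => j _.
by rewrite gw.
Qed.

(** The bounds on [k] say that [k] is the ceiling of [|E(G)| / m]. *)
Lemma exact_covering k m :
    0 < chromatic_index G -> chromatic_index G * m <= #|edges G| ->
    k.-1 * m < #|edges G| <= k * m ->
  exists2 C : {set {set {set G}}}, covering m m C & #|C| <= k.
Proof.
move=> q_gt0 leqE /andP[ltkE leEk].
suff [f cf lew] : exists2 f : {ffun 'I_k -> {set {set G}}},
    matching_cover f & k * m <= weight f.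
  have [|g cg wg] := matching_cover_trim (w := k * m) cf; first by rewrite leEk.
  by apply: covering_of_matching_cover cg _; rewrite wg leqnn.
have m_gt0 : 0 < m.
  by case: (m) ltkE leEk => // /leq_trans lt /lt; rewrite !muln0.
have leqk : chromatic_index G <= k.
  by rewrite -(leq_pmul2r m_gt0) (leq_trans leqE).
have [ltqk|lekq] := ltnP (chromatic_index G) k; last first.
  have /chromatic_index_leP[f cf] := leqk; exists f => //.
  apply: leq_trans (leq_card_weight cf); apply: leq_trans leqE.
  by rewrite leq_mul2r lekq orbT.
(* Some class of a (k-1)-colouring has at least m edges; used twice, it lifts
   the weight to k * m. *)
case: k => // k in leqk ltqk ltkE leEk *.
have /chromatic_index_leP[f cf] : chromatic_index G <= k by [].
have k_gt0 : 0 < k by apply: leq_trans q_gt0 _.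
have lekf : k * m <= weight f.
  by apply: leq_trans (leq_card_weight cf); apply: ltnW.
have [g cg wg] := matching_cover_dup k_gt0 cf lekf.
by exists g => //; rewrite mulSn addnC (leq_trans _ wg) // leq_add2r.
Qed.

End Covers.

(** * The three ranges of the average class size *)

Lemma ceil_div_nat (e m k : nat) :
    (0 < e)%N -> (0 < m)%N -> k = `|Num.ceil (e%:R / m%:R : rat)|%N ->
  (k.-1 * m < e <= k * m)%N.
Proof.
move=> e_gt0 m_gt0 k_def.
have mR : 0 < m%:R :> rat by rewrite ltr0n.
have c_gt0 : 0 < Num.ceil (e%:R / m%:R : rat).
  by rewrite ceil_gt0 divr_gt0 ?ltr0n.
have Dk : Num.ceil (e%:R / m%:R : rat) = k%:Z by rewrite k_def gez0_abs // ltW.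
have k_gt0 : (0 < k)%N by rewrite k_def absz_gt0 gt_eqF.
apply/andP; split.
  rewrite ltnNge; apply/negP=> leek.
  have : Num.ceil (e%:R / m%:R : rat) <= k.-1%:Z.
    by rewrite ceil_le_int ler_pdivrMr // -pmulrn -natrM ler_nat.
  by rewrite Dk lez_nat leqNgt prednK ?leqnn.
have := le_refl (Num.ceil (e%:R / m%:R : rat)).
by rewrite {2}Dk ceil_le_int ler_pdivrMr // -pmulrn -natrM ler_nat.
Qed.

Unset Implicit Arguments.

Theorem theorem1 (l m : nat) (l_gt0 : (0 < l)%N) (m_gt0 : (0 < m)%N)
    (le_lm : (l <= m)%N) (G : sgraph) (G_edge : edges G != set0) :
  let r : rat := #|edges G|%:R / (chromatic_index G)%:R in
  [/\ m%:R <= r ->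
        excessive_index2 l m G =
          Some `|Num.ceil (#|edges G|%:R / m%:R : rat)|%N,
      l%:R <= r <= m%:R ->
        excessive_index2 l m G = Some (chromatic_index G)
    & r <= l%:R ->
        excessive_index2 l m G = excessive_index l G].
Proof.
have q_gt0 := chromatic_index_gt0 G_edge.
have qR : 0 < (chromatic_index G)%:R :> rat by rewrite ltr0n.
move=> r; split.
- rewrite ler_pdivlMr // -natrM ler_nat mulnC => leqE.
  have E_gt0 : (0 < #|edges G|)%N by rewrite card_gt0.
  set k := `|_|%N; have kE := ceil_div_nat E_gt0 m_gt0 (erefl k).
  have [C covC leCk] := exact_covering q_gt0 leqE kE.
  apply: excessive_index2_eq (sub_covering le_lm (leqnn m) covC) leCk _.
  move=> D /covering_bounds[_ leED]; case/andP: kE => ltkE _.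
  have := leq_trans ltkE leED; rewrite ltn_pmul2r //.
  by case: (k).
- rewrite ler_pdivlMr // ler_pdivrMr // -!natrM !ler_nat => /andP[lE Em].
  have /chromatic_index_leP[f cf] := leqnn (chromatic_index G).
  have [|g cg wg] := matching_cover_trim (w := #|edges G|) cf.
    by rewrite leqnn leq_card_weight.
  have [|C covC leCq] := covering_of_matching_cover (l := l) (m := m) cg.
    by rewrite wg mulnC lE mulnC.
  by apply: excessive_index2_eq covC leCq _ => D /covering_bounds[].
rewrite ler_pdivrMr // -natrM ler_nat mulnC => leEq.
apply: eq_excessive_index2 => C covC; first exact: covering_trim_size covC.
by exists C => //; apply: sub_covering covC.
Qed.
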